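(* Let $S,T,P,Q$ be $n\times n$ complex matrices. Then $$\begin{aligned}\left\|\begin{bmatrix}S&P\\Q&T\end{bmatrix}\right\|^2_{\mathbf{ber}}\leq{}&\max\left\{\mathbf{ber}(|S|^2+i|Q|^2),\mathbf{ber}(|T|^2+i|P|^2)\right\}\\&\cdot\max\left\{\mathbf{ber}\big(S(|S|^2)^\dagger S^*+iP(|P|^2)^\dagger P^*\big),\mathbf{ber}\big(T(|T|^2)^\dagger T^*+iQ(|Q|^2)^\dagger Q^*\big)\right\}\\&+\frac12\max\left\{\left\||S|^2+|Q|^2\right\|_{\mathbf{ber}},\left\||P|^2+|T|^2\right\|_{\mathbf{ber}}\right\}+\frac12\left(\|Q^*T\|+\|P^*S\|\right).\end{aligned}$$
   Context: $T^*$ is the adjoint, $|T|=\sqrt{T^*T}$ (so $|T|^2=T^*T$), $T^\dagger$ is the Moore–Penrose inverse, $\|\cdot\|$ is the usual operator norm, and $i$ is the imaginary unit. $\mathbb{C}^n$ with its standard inner product is regarded as a reproducing kernel Hilbert space of functions on $\{1,\dots,n\}$; its reproducing kernels are the standard basis vectors $e_1,\dots,e_n$. Thus for an $n\times n$ matrix $T$, the Berezin number is $\mathbf{ber}(T)=\max_{j}|\langle Te_j,e_j\rangle|$ and the Berezin norm is $\|T\|_{\mathbf{ber}}=\max_{j,l}|\langle Te_j,e_l\rangle|$. The direct sum $\mathbb{C}^n\oplus\mathbb{C}^n$ is regarded as a reproducing kernel Hilbert space on the product set $\{1,\dots,n\}\times\{1,\dots,n\}$, the reproducing kernel at $(j,l)$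 being $(e_j,e_l)$, with normalized kernel $\hat k_{(j,l)}=\frac{1}{\sqrt2}(e_j,e_l)$. For a $2\times2$ block matrix $M$ with $n\times n$ blocks, acting on $\mathbb{C}^n\oplus\mathbb{C}^n$, $\|M\|_{\mathbf{ber}}=\max|\langle M\hat k_{(j,l)},\hat k_{(j',l')}\rangle|$ over all $j,l,j',l'\in\{1,\dots,n\}$. *)

(* Defs.v *)
From HB Require Import structures.
From mathcomp Require Import all_boot all_order all_algebra.
From mathcomp Require Import all_classical all_reals.
From mathcomp Require Import complex.

Set Implicit Arguments.
Unset Strict Implicit.
Unset Printing Implicit Defensive.

Import Order.TTheory GRing.Theory Num.Theory.
Local Open Scope ring_scope.
Local Open Scope sesquilinear_scope.

Notation modulus z := (ComplexField.Normc.normc z).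

(* Linear in the first variable, conjugate-linear in the second. *)
Definition inner (R : realType) (m : nat) (x y : 'cV[R[i]]_m) : R[i] :=
  (y ^t* *m x) 0 0.

Definition vnorm (R : realType) (m : nat) (x : 'cV[R[i]]_m) : R :=
  Num.sqrt (complex.Re (inner x x)).

Definition opnorm (R : realType) (m n : nat) (A : 'M[R[i]]_(m, n)) : R :=
  sup [set vnorm (A *m x) | x in [set x : 'cV[R[i]]_n | vnorm x <= 1]]%classic.

Definition psdmx (R : realType) (n : nat) (A : 'M[R[i]]_n) : Prop :=
  A ^t* = A /\ forall x : 'cV[R[i]]_n, 0 <= inner (A *m x) x.

(* Meaningful when [A] is positive semidefinite, see [sqrtmx_spec]. *)
Definition sqrtmx (R : realType) (n : nat) (A : 'M[R[i]]_n) : 'M[R[i]]_n :=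
  invmx (spectralmx A) *m diag_mx (map_mx sqrtC (spectral_diag A))
    *m spectralmx A.

Lemma sqrtmx_spec (R : realType) (n : nat) (A : 'M[R[i]]_n) :
  psdmx A -> psdmx (sqrtmx A) /\ sqrtmx A *m sqrtmx A = A.
Proof.
move=> [Ah Ap]; rewrite /sqrtmx.
have An : A \is normalmx by apply/normalmxP; rewrite Ah.
have /unitarymxP UU := spectral_unitarymx A.
have U1 := spectral_unit A.
have eA := orthomx_spectralP An.
rewrite invmx_unitary ?spectral_unitarymx //.
rewrite invmx_unitary ?spectral_unitarymx // in eA.
set P := spectralmx A in UU U1 eA *; set d := spectral_diag A in eA *.
have d0 j : 0 <= d 0 j.
  have := Ap (P ^t* *m delta_mx j 0); rewrite {1}eA /inner.
  rewrite trmx_mul map_mxM trmxCK !mulmxA.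
  rewrite -(mulmxA _ P (P ^t*)) UU mulmx1 -(mulmxA _ P (P ^t*)) UU mulmx1.
  by rewrite trmx_delta map_delta_mx -rowE row_diag_mx -scalemxAl mul_delta_mx mxE mxE !eqxx mulr1.
split; last first.
  rewrite !mulmxA -(mulmxA _ P (P ^t*)) UU mulmx1 -(mulmxA (P ^t*)).
  rewrite mulmx_diag [RHS]eA; congr (_ *m diag_mx _ *m _).
  by apply/rowP => j; rewrite !mxE -expr2 sqrtCK.
split.
  rewrite !trmx_mul !map_mxM trmxCK mulmxA tr_diag_mx map_diag_mx.
  congr (_ *m diag_mx _ *m _).
  apply/rowP => j; rewrite !mxE; apply/CrealP/ger0_real.
  by rewrite sqrtC_ge0.
move=> x; rewrite /inner !mulmxA.
have -> : x ^t* *m P ^t* = (P *m x) ^t* by rewrite trmx_mul map_mxM.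
rewrite -mulmxA; set y := P *m x.
rewrite mxE; apply: sumr_ge0 => j _; rewrite mul_mx_diag !mxE mulrAC.
rewrite mulr_ge0 ?sqrtC_ge0 //; first by rewrite mulrC mul_conjC_ge0.
Qed.

Lemma gram_psd (R : realType) (n : nat) (T : 'M[R[i]]_n) : psdmx (T ^t* *m T).
Proof.
split=> [|x]; first by rewrite trmx_mul map_mxM trmxCK.
have -> : inner (T ^t* *m T *m x) x = ((T *m x) ^t* *m (T *m x)) 0 0.
  by rewrite /inner trmx_mul map_mxM !mulmxA.
by rewrite mxE sumr_ge0 // => j _; rewrite !mxE mulrC mul_conjC_ge0.
Qed.

Definition absmx (R : realType) (n : nat) (T : 'M[R[i]]_n) : 'M[R[i]]_n :=
  sqrtmx (T ^t* *m T).

Lemma absmx_psd (R : realType) (n : nat) (T : 'M[R[i]]_n) : psdmx (absmx T).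
Proof. exact: (sqrtmx_spec (gram_psd T)).1. Qed.

Lemma absmx_sqr (R : realType) (n : nat) (T : 'M[R[i]]_n) :
  absmx T ^+ 2 = T ^t* *m T.
Proof. by rewrite expr2; exact: (sqrtmx_spec (gram_psd T)).2. Qed.

(* The four Penrose equations. *)
Definition is_mpinv (R : realType) (m n : nat) (A : 'M[R[i]]_(m, n))
    (X : 'M[R[i]]_(n, m)) : Prop :=
  [/\ A *m X *m A = A, X *m A *m X = X,
      (A *m X) ^t* = A *m X & (X *m A) ^t* = X *m A].

Definition mpinv (R : realType) (m n : nat) (A : 'M[R[i]]_(m, n)) :
    'M[R[i]]_(n, m) :=
  xget 0 [set X | is_mpinv A X]%classic.

Lemma gram_unit (R : realType) (m n : nat) (B : 'M[R[i]]_(m, n)) :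
  row_free B -> B *m B ^t* \in unitmx.
Proof.
move=> fB; rewrite -row_free_unit; apply/row_freeP.
have k0 : kermx (B *m B ^t*) = 0.
  apply/row_matrixP => i; rewrite row0; set u := row i _.
  have uz : u *m (B *m B ^t*) = 0.
    by apply: sub_kermxP; rewrite row_sub.
  apply: (row_free_inj fB); rewrite mul0mx.
  apply/eqP; rewrite -(dnorm_eq0 (@dotmx R[i] n)); apply/eqP; rewrite [LHS]dotmxE.
  by rewrite trmx_mul map_mxM mulmxA -(mulmxA u) uz mul0mx mxE.
by exists (invmx (B *m B ^t*)); apply: mulmxV;
   rewrite -row_free_unit -kermx_eq0 k0.
Qed.

Lemma mpinv_exists (R : realType) (m n : nat) (A : 'M[R[i]]_(m, n)) :
  exists X, is_mpinv A X.
Proof.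
have fE : row_free ((col_base A) ^t*).
  by rewrite /row_free mxrank_map mxrank_tr; exact: col_base_full.
have := mulmx_base A; move: (col_base A) (row_base A) (row_base_free A) fE.
move: (\rank A) => r E F fF fE /esym AE.
have uF : F *m F ^t* \in unitmx by exact: gram_unit.
have uE : E ^t* *m E \in unitmx by have := gram_unit fE; rewrite trmxCK.
have hF : (invmx (F *m F ^t*)) ^t* = invmx (F *m F ^t*).
  by rewrite trmx_inv map_invmx trmx_mul map_mxM trmxCK.
have hE : (invmx (E ^t* *m E)) ^t* = invmx (E ^t* *m E).
  by rewrite trmx_inv map_invmx trmx_mul map_mxM trmxCK.
have := mulmxV uF; have := mulVmx uE.
move: (invmx (F *m _)) (invmx (_ *m E)) hF hE => iF iE hF hE EK FK.
have AX : A *m (F ^t* *m iF *m (iE *m E ^t*)) = E *m iE *m E ^t*.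
  have -> : A *m (F ^t* *m iF *m (iE *m E ^t*))
      = E *m (F *m F ^t* *m iF) *m iE *m E ^t* by rewrite AE !mulmxA.
  by rewrite FK mulmx1.
have XA : F ^t* *m iF *m (iE *m E ^t*) *m A = F ^t* *m iF *m F.
  have -> : F ^t* *m iF *m (iE *m E ^t*) *m A
      = F ^t* *m iF *m (iE *m (E ^t* *m E)) *m F by rewrite AE !mulmxA.
  by rewrite EK mulmx1.
exists (F ^t* *m iF *m (iE *m E ^t*)); split.
- have -> : A *m (F ^t* *m iF *m (iE *m E ^t*)) *m A
      = E *m (iE *m (E ^t* *m E)) *m F by rewrite AX AE !mulmxA.
  by rewrite EK mulmx1 -AE.
- rewrite XA.
  have -> : F ^t* *m iF *m F *m (F ^t* *m iF *m (iE *m E ^t*))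
      = F ^t* *m iF *m (F *m F ^t* *m iF) *m (iE *m E ^t*) by rewrite !mulmxA.
  by rewrite FK mulmx1.
- by rewrite AX !trmx_mul !map_mxM trmxCK hE mulmxA.
- by rewrite XA !trmx_mul !map_mxM trmxCK hF mulmxA.
Qed.

Lemma mpinvP (R : realType) (m n : nat) (A : 'M[R[i]]_(m, n)) :
  is_mpinv A (mpinv A).
Proof. by have [X AX] := mpinv_exists A; apply: (xgetPex 0); exists X. Qed.

Lemma mpinv_unique (R : realType) (m n : nat) (A : 'M[R[i]]_(m, n)) X Y :
  is_mpinv A X -> is_mpinv A Y -> X = Y.
Proof.
move=> [X1 X2 X3 X4] [Y1 Y2 Y3 Y4].
have AXY : A *m X = A *m Y.
  transitivity (A *m Y *m (A *m X)); first by rewrite mulmxA Y1.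
  by rewrite -Y3 -X3 -map_mxM -trmx_mul mulmxA X1 Y3.
have XAY : X *m A = Y *m A.
  transitivity (X *m A *m (Y *m A)); first by rewrite -mulmxA (mulmxA A) Y1.
  by rewrite -X4 -Y4 -map_mxM -trmx_mul -mulmxA (mulmxA A) X1 Y4.
by rewrite -X2 XAY -mulmxA AXY mulmxA Y2.
Qed.

(* [k] is the family of normalized reproducing kernels.  All the terms of the
   maxima below are nonnegative, so starting from 0 does not change them. *)
Definition berezin_number (R : realType) (I : finType) (m : nat)
    (k : I -> 'cV[R[i]]_m) (A : 'M[R[i]]_m) : R :=
  \big[Num.max/0]_(s : I) modulus (inner (A *m k s) (k s)).

Definition berezin_norm (R : realType) (I : finType) (m : nat)
    (k : I -> 'cV[R[i]]_m) (A : 'M[R[i]]_m) : R :=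
  \big[Num.max/0]_(s : I) \big[Num.max/0]_(t : I)
    modulus (inner (A *m k s) (k t)).

Definition kernel_std (R : realType) (n : nat) (j : 'I_n) : 'cV[R[i]]_n :=
  delta_mx j 0.

(* C^n (+) C^n is a space of functions on the product {1..n} x {1..n}, with
   kernel (e_j, e_l) at (j, l); the vectors below are normalized. *)
Definition nkernel_sum (R : realType) (n : nat) (s : 'I_n * 'I_n) :
    'cV[R[i]]_(n + n) :=
  ((Num.sqrt 2)^-1)%:C%C *: col_mx (kernel_std R s.1) (kernel_std R s.2).

Definition ber (R : realType) (n : nat) (A : 'M[R[i]]_n) : R :=
  berezin_number (@kernel_std R n) A.

Definition bernorm (R : realType) (n : nat) (A : 'M[R[i]]_n) : R :=
  berezin_norm (@kernel_std R n) A.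

Definition bernorm2 (R : realType) (n : nat) (M : 'M[R[i]]_(n + n)) : R :=
  berezin_norm (@nkernel_sum R n) M.

(* Main.v *)
Require Import Defs.
From mathcomp Require Import all_boot all_order all_algebra.
From mathcomp Require Import all_classical all_reals.
From mathcomp Require Import complex.
From mathcomp Require Import ring lra.
Set Implicit Arguments.
Unset Strict Implicit.
Unset Printing Implicit Defensive.
Import Order.TTheory GRing.Theory Num.Theory.
Local Open Scope ring_scope.
Local Open Scope sesquilinear_scope.

(** Write the block matrix as A + B with A = diag(S, T) the diagonal part and
    B the off-diagonal part, and let k, k' be two normalized kernels.  Then
    |<(A + B)k, k'>|^2 is at most |<Ak, k'>|^2 + |<Bk, k'>|^2
    + 2 |<Ak, k'>| |<Bk, k'>|, and the squares and the cross term are bounded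
    separately ([modulus_add_cs]).

    Squares.  For a matrix X, the matrix X (|X|^2)^+ X^* is the orthogonal
    projection onto the range of X, so k' may be replaced by its projection in
    <Xk, k'> ([inner_rangeproj]) before Cauchy-Schwarz is applied.  This bounds
    |<Xk, k'>|^2 by |Xk|^2 |proj k'|^2, whose two factors are diagonal Berezin
    values of |X|^2 and of the projection.  Summing over X = A, B gives a real
    expression a c + b d, and a c + b d <= |a + ib| |c + id| ([modulus_cs]).
    This is how the matrices |S|^2 + i|Q|^2 arise.

    Cross term.  Buzano's inequality ([buzano]) bounds
    2 |<Ak, k'>| |<Bk, k'>| by |Ak| |Bk| + |<Ak, Bk>|; the arithmetic-geometric
    mean inequality turns the first summand into the bernorm terms, and the
    second is <B^*A k, k>, whose blocks are Q^*T and P^*S.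

    Finally, each kernel is a pair (e_j, e_l) divided by sqrt 2, so every inner
    product above is the mean of two inner products in C^n, and a mean is at
    most the maximum ([modulus_pairvec_add]). *)

(** * Moduli of complex numbers *)

Section Moduli.
Variable R : realType.

Lemma modulusE (a : R[i]) : `|a| = (modulus a)%:C%C.
Proof. by []. Qed.

Lemma modulus_ge0 (a : R[i]) : 0 <= modulus a.
Proof. by rewrite -lecR -modulusE; exact: normr_ge0. Qed.

(** Cauchy-Schwarz in the plane: the left-hand side is the real part of
    (a + ib) times the conjugate of (c + id). *)
Lemma modulus_cs (a b c d : R) :
  a * c + b * d <= modulus (a%:C + 'i * b%:C)%C * modulus (c%:C + 'i * d%:C)%C.
Proof.
have e (s t : R) : (s%:C + 'i * t%:C)%C = (s +i* t)%C by rewrite [RHS]complexE.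
rewrite !e /= -sqrtrM ?addr_ge0 ?sqr_ge0 //.
apply: le_trans (ler_norm _) _; rewrite -sqrtr_sqr ler_sqrt.
  rewrite -subr_ge0.
  have -> : (a ^+ 2 + b ^+ 2) * (c ^+ 2 + d ^+ 2) - (a * c + b * d) ^+ 2
            = (a * d - b * c) ^+ 2 by ring.
  exact: sqr_ge0.
by rewrite mulr_ge0 ?addr_ge0 ?sqr_ge0.
Qed.

Lemma modulus_mean (z w : R[i]) (a b : R) :
  modulus z <= a -> modulus w <= b ->
  modulus (2^-1 * (z + w)) <= 2^-1 * (a + b).
Proof.
move=> za wb; rewrite ComplexField.Normc.normcM.
have -> : modulus (2^-1 : R[i]) = 2^-1.
  by apply: complexI; rewrite -modulusE ger0_norm ?invr_ge0 // fmorphV rmorph_nat.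
by rewrite ler_pM2l ?invr_gt0 // (le_trans (le_normcD _ _)) // lerD.
Qed.

(** The pairing of the terms matters: it gathers the quantities attached to one
    component of a kernel pair, so that each half is one Berezin value. *)
Lemma mean_addi (p q r s : R[i]) : 2^-1 * (p + q) + 'i%C * (2^-1 * (r + s))
  = 2^-1 * ((p + 'i%C * r) + (q + 'i%C * s)).
Proof. by ring. Qed.

Lemma mean_le_max (a b : R) : 2^-1 * (a + b) <= Num.max a b.
Proof.
have h1 : a <= Num.max a b by rewrite le_max lexx.
have h2 : b <= Num.max a b by rewrite le_max lexx orbT.
lra.
Qed.

End Moduli.

(** * Inner products, Cauchy-Schwarz and Buzano *)

Section InnerProduct.
Variables (R : realType) (m : nat).
Implicit Types (x y z u : 'cV[R[i]]_m) (a : R[i]).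

Lemma innerE x y : inner x y = dotmx x^T y^T.
Proof.
rewrite dotmxE trmxK /inner !mxE.
by apply: eq_bigr => j _; rewrite !mxE mulrC.
Qed.

Lemma innerDl x y z : inner (x + y) z = inner x z + inner y z.
Proof. by rewrite /inner mulmxDr mxE. Qed.

Lemma innerDr x y z : inner x (y + z) = inner x y + inner x z.
Proof. by rewrite /inner linearD /= map_mxD mulmxDl mxE. Qed.

Lemma innerZl a x y : inner (a *: x) y = a * inner x y.
Proof. by rewrite /inner -scalemxAr mxE. Qed.

Lemma innerZr a x y : inner x (a *: y) = a^* * inner x y.
Proof. by rewrite /inner linearZ /= map_mxZ -scalemxAl mxE. Qed.

Lemma innerC x y : inner y x = (inner x y)^*.
Proof.
rewrite /inner !mxE rmorph_sum; apply: eq_bigr => j _.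
by rewrite rmorphM !mxE /= conjCK mulrC.
Qed.

Lemma innerxx x : inner x x = (vnorm x ^+ 2)%:C%C.
Proof.
have h : 0 <= inner x x by rewrite innerE dnorm_ge0.
move: (h); rewrite lecE /= => /andP[_ h'].
by rewrite sqr_sqrtr // RRe_real // ger0_real.
Qed.

Lemma vnorm_ge0 x : 0 <= vnorm x.
Proof. exact: sqrtr_ge0. Qed.

Lemma cauchy_schwarz x y : modulus (inner x y) <= vnorm x * vnorm y.
Proof.
rewrite -(ler_pXn2r (n := 2)) ?nnegrE ?mulr_ge0 ?vnorm_ge0 ?modulus_ge0 //.
have : `|inner x y| ^+ 2 <= inner x x * inner y y.
  by rewrite !innerE; exact: (CauchySchwarz (@dotmx R[i] m) x^T y^T).1.
by rewrite !innerxx modulusE -rmorphXn -rmorphM lecR exprMn.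
Qed.

End InnerProduct.

Lemma inner_mull (R : realType) (p m : nat) (A : 'M[R[i]]_(p, m))
  (x : 'cV[R[i]]_m) (y : 'cV[R[i]]_p) : inner (A *m x) y = inner x (A ^t* *m y).
Proof. by rewrite /inner trmx_mul map_mxM trmxCK mulmxA. Qed.

Lemma inner_mulr (R : realType) (p m : nat) (A : 'M[R[i]]_(p, m))
  (x : 'cV[R[i]]_p) (y : 'cV[R[i]]_m) : inner x (A *m y) = inner (A ^t* *m x) y.
Proof. by rewrite inner_mull trmxCK. Qed.

Lemma inner_col_mx (R : realType) (p m : nat) (a c : 'cV[R[i]]_p)
  (b d : 'cV[R[i]]_m) :
  inner (col_mx a b) (col_mx c d) = inner a c + inner b d.
Proof. by rewrite /inner tr_col_mx map_row_mx mul_row_col mxE. Qed.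

Section Vectors.
Variables (R : realType) (m : nat).
Implicit Types (x y u f g : 'cV[R[i]]_m).

(** Apply Cauchy-Schwarz to r and y, where r = 2 <x, u> u - x is the reflection
    of x in the line of u: it has the norm of x, and
    <r, y> = 2 <x, u> <u, y> - <x, y>. *)
Lemma buzano x y u : vnorm u = 1 ->
  2 * (modulus (inner x u) * modulus (inner y u))
    <= vnorm x * vnorm y + modulus (inner x y).
Proof.
move=> u1; have uu : inner u u = 1 by rewrite innerxx u1 expr1n.
pose r := (2 * inner x u) *: u + (-1) *: x.
have rr : vnorm r = vnorm x.
  apply/eqP; rewrite -(eqrXn2 (n := 2)) ?vnorm_ge0 //; apply/eqP/complexI.
  rewrite -!innerxx /r innerDl !innerDr !innerZl !innerZr uu (innerC x u).
  rewrite rmorphM rmorphN1 rmorph_nat /=.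
  ring.
have e : inner x u * inner u y *+ 2 = inner r y + inner x y.
  by rewrite innerDl !innerZl; ring.
have cs := cauchy_schwarz r y; rewrite rr in cs.
have sym : modulus (inner u y) = modulus (inner y u).
  by apply: complexI; rewrite -!modulusE innerC norm_conjC.
rewrite -sym -ComplexField.Normc.normcM mulr_natl -normcMn e.
by rewrite (le_trans (le_normcD _ _)) // lerD2r.
Qed.

(** The vectors f and g stand for the projections of u onto spaces containing
    x and y.  The product term keeps their norms, where f = g = u would only
    give the norm of u. *)
Lemma modulus_add_cs x y u f g : vnorm u = 1 ->
    inner x u = inner x f -> inner y u = inner y g ->
  modulus (inner (x + y) u) ^+ 2 <=
    modulus (inner x x + 'i%C * inner y y)
      * modulus (inner f f + 'i%C * inner g g)
    + 2^-1 * (vnorm x ^+ 2 + vnorm y ^+ 2) + modulus (inner x y).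
Proof.
move=> u1 xf yg.
have h1 := cauchy_schwarz x f; rewrite -xf in h1.
have h2 := cauchy_schwarz y g; rewrite -yg in h2.
have h3 := buzano x y u1.
have h4 := modulus_cs (vnorm x ^+ 2) (vnorm y ^+ 2) (vnorm f ^+ 2) (vnorm g ^+ 2).
rewrite -!innerxx in h4.
have h5 := le_normcD (inner x u) (inner y u).
have p (z : R[i]) := modulus_ge0 z.
have q1 : modulus (inner x u) ^+ 2 <= (vnorm x * vnorm f) ^+ 2.
  by rewrite ler_pXn2r // nnegrE ?mulr_ge0 ?vnorm_ge0.
have q2 : modulus (inner y u) ^+ 2 <= (vnorm y * vnorm g) ^+ 2.
  by rewrite ler_pXn2r // nnegrE ?mulr_ge0 ?vnorm_ge0.
have q3 : modulus (inner (x + y) u) ^+ 2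
    <= (modulus (inner x u) + modulus (inner y u)) ^+ 2.
  by rewrite innerDl ler_pXn2r // nnegrE ?addr_ge0.
(* The arithmetic-geometric mean inequality for the norms of x and y. *)
have q4 : 0 <= (vnorm x - vnorm y) ^+ 2 by rewrite sqr_ge0.
rewrite !exprMn in q1 q2; nra.
Qed.

End Vectors.

Lemma inner_delta (R : realType) (m : nat) (x : 'cV[R[i]]_m) (j : 'I_m) :
  inner x (kernel_std R j) = x j 0.
Proof. by rewrite /inner /kernel_std trmx_delta map_delta_mx -rowE mxE. Qed.

Lemma vnorm_delta (R : realType) (m : nat) (j : 'I_m) : vnorm (kernel_std R j) = 1.
Proof. by rewrite /vnorm inner_delta mxE !eqxx sqrtr1. Qed.

Lemma vnorm_sqr (R : realType) (m : nat) (x : 'cV[R[i]]_m) :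
  vnorm x ^+ 2 = \sum_j modulus (x j 0) ^+ 2.
Proof.
apply: complexI; rewrite -innerxx /inner mxE rmorph_sum.
apply: eq_bigr => j _; rewrite rmorphXn /= -modulusE normCK !mxE.
by rewrite mulrC.
Qed.

(** Each coordinate of A x is the inner product of x with a fixed vector, so
    the unit ball has a bounded image.  The set needs an upper bound for its
    supremum to be meaningful. *)
Lemma opnorm_has_ubound (R : realType) (p m : nat) (A : 'M[R[i]]_(p, m)) :
  has_ubound
    [set vnorm (A *m x) | x in [set x : 'cV[R[i]]_m | vnorm x <= 1]]%classic.
Proof.
exists (Num.sqrt (\sum_j vnorm (A ^t* *m kernel_std R j) ^+ 2)) => _ [x /= x1 <-].
rewrite -(ger0_norm (vnorm_ge0 (A *m x))) -sqrtr_sqr ler_sqrt; last first.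
  by apply: sumr_ge0 => j _; rewrite sqr_ge0.
rewrite vnorm_sqr; apply: ler_sum => j _.
rewrite ler_pXn2r ?nnegrE ?modulus_ge0 ?vnorm_ge0 // -inner_delta inner_mull.
by rewrite (le_trans (cauchy_schwarz _ _)) // ler_piMl ?vnorm_ge0.
Qed.

Lemma modulus_inner_opnorm (R : realType) (p m : nat) (A : 'M[R[i]]_(p, m)) x y :
  vnorm x = 1 -> vnorm y = 1 -> modulus (inner (A *m x) y) <= opnorm A.
Proof.
move=> x1 y1; apply: le_trans (cauchy_schwarz _ _) _; rewrite y1 mulr1.
by apply: (ub_le_sup (opnorm_has_ubound A)); exists x => //=; rewrite x1.
Qed.

(** * Projection onto the range *)

(** The Penrose equations are stable under adjunction, so the adjoint of the
    inverse of B is an inverse of B^* = B, and inverses are unique. *)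
Lemma mpinv_herm (R : realType) (n : nat) (B : 'M[R[i]]_n) :
  B ^t* = B -> (mpinv B) ^t* = mpinv B.
Proof.
move=> Bh; have [h1 h2 h3 h4] := mpinvP B.
apply: (mpinv_unique (A := B)); last exact: mpinvP.
have e1 : B *m (mpinv B) ^t* = mpinv B *m B.
  by rewrite -h4 trmx_mul map_mxM Bh.
have e2 : (mpinv B) ^t* *m B = B *m mpinv B.
  by rewrite -h3 trmx_mul map_mxM Bh.
split.
- have := congr1 (fun M => M ^t*) h1.
  by rewrite !trmx_mul !map_mxM Bh mulmxA.
- have := congr1 (fun M => M ^t*) h2.
  by rewrite !trmx_mul !map_mxM Bh mulmxA.
- by rewrite e1 h4.
- by rewrite e2 h3.
Qed.

Lemma gram_inj (R : realType) (n : nat) (B : 'M[R[i]]_n) :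
  B ^t* *m B = 0 -> B = 0.
Proof.
move=> B0; apply/matrixP => i j; rewrite [RHS]mxE.
have v0 : vnorm (B *m kernel_std R j) = 0.
  apply/eqP; rewrite -sqrf_eq0; apply/eqP/complexI.
  by rewrite -innerxx inner_mull mulmxA B0 mul0mx /inner trmx0 map_mx0 mul0mx mxE.
have := cauchy_schwarz (B *m kernel_std R j) (kernel_std R i).
rewrite v0 mul0r inner_delta /kernel_std -colE mxE => h.
apply: ComplexField.Normc.eq0_normc; apply/eqP; rewrite eq_le h.
exact: modulus_ge0.
Qed.

(** Since (|A|^2)^+ A^* is the Moore-Penrose inverse of A, this is the orthogonal
    projection onto the range of A. *)
Definition rangeproj (R : realType) (n : nat) (A : 'M[R[i]]_n) : 'M[R[i]]_n :=
  A *m mpinv (absmx A ^+ 2) *m A ^t*.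

Section RangeProjection.
Variables (R : realType) (n : nat) (A : 'M[R[i]]_n).

Lemma rangeproj_herm : (rangeproj A) ^t* = rangeproj A.
Proof.
rewrite /rangeproj absmx_sqr !trmx_mul !map_mxM trmxCK mulmxA.
by rewrite mpinv_herm // trmx_mul map_mxM trmxCK.
Qed.

Lemma rangeproj_idem : rangeproj A *m rangeproj A = rangeproj A.
Proof.
rewrite /rangeproj absmx_sqr; have [_ h2 _ _] := mpinvP (A ^t* *m A).
by rewrite -[in RHS]h2 !mulmxA.
Qed.

(** The difference D of the two sides satisfies A^* D = 0 by the first Penrose
    equation for A^* A.  As D = A Y for some Y, also D^* D = 0. *)
Lemma rangeproj_id : rangeproj A *m A = A.
Proof.
apply/subr0_eq; set D := _ - A; apply: gram_inj.
have AD : A ^t* *m D = 0.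
  rewrite mulmxBr /rangeproj absmx_sqr; have [h1 _ _ _] := mpinvP (A ^t* *m A).
  by rewrite -[X in _ - X]h1 !mulmxA subrr.
have DA : D ^t* *m A = 0.
  by rewrite -[LHS]trmxCK trmx_mul map_mxM trmxCK AD trmx0 map_mx0.
have DP : D ^t* *m rangeproj A = 0.
  by rewrite /rangeproj !mulmxA DA !mul0mx.
by rewrite {2}/D mulmxBr mulmxA DP DA mul0mx subrr.
Qed.

Lemma inner_rangeproj x y : inner (A *m x) y = inner (A *m x) (rangeproj A *m y).
Proof. by rewrite inner_mulr rangeproj_herm mulmxA rangeproj_id. Qed.

Lemma inner_rangeproj_diag x :
  inner (rangeproj A *m x) x = inner (rangeproj A *m x) (rangeproj A *m x).
Proof. by rewrite inner_mulr rangeproj_herm mulmxA rangeproj_idem. Qed.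

Lemma inner_absmx_sqr x : inner (absmx A ^+ 2 *m x) x = inner (A *m x) (A *m x).
Proof. by rewrite absmx_sqr inner_mulr mulmxA. Qed.

End RangeProjection.

(** * Kernels of the direct sum *)

Section Berezin.
Variables (R : realType) (n : nat).
Implicit Types (A B : 'M[R[i]]_n) (j : 'I_n).
Local Notation e := (@kernel_std R n).

Lemma le_ber A j : modulus (inner (A *m e j) (e j)) <= ber A.
Proof. exact: (le_bigmax _ (fun s => modulus (inner (A *m e s) (e s)))). Qed.

Lemma le_bernorm A j : modulus (inner (A *m e j) (e j)) <= bernorm A.
Proof.
apply: le_trans (le_bigmax _ (fun s => \big[Num.max/0]_t
  modulus (inner (A *m e s) (e t))) j).
exact: (le_bigmax _ (fun t => modulus (inner (A *m e j) (e t)))).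
Qed.

Lemma le_ber_absmx A B j :
  modulus (inner (A *m e j) (A *m e j) + 'i%C * inner (B *m e j) (B *m e j))
    <= ber (absmx A ^+ 2 + 'i%C *: absmx B ^+ 2).
Proof.
by rewrite -!inner_absmx_sqr -innerZl -innerDl scalemxAl -mulmxDl le_ber.
Qed.

Lemma le_ber_rangeproj A B j :
  modulus (inner (rangeproj A *m e j) (rangeproj A *m e j)
           + 'i%C * inner (rangeproj B *m e j) (rangeproj B *m e j))
    <= ber (rangeproj A + 'i%C *: rangeproj B).
Proof.
by rewrite -!inner_rangeproj_diag -innerZl -innerDl scalemxAl -mulmxDl le_ber.
Qed.

Lemma le_bernorm_absmx A B j :
  vnorm (A *m e j) ^+ 2 + vnorm (B *m e j) ^+ 2
    <= bernorm (absmx A ^+ 2 + absmx B ^+ 2).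
Proof.
apply: le_trans (le_bernorm _ j).
have <- : (vnorm (A *m e j) ^+ 2 + vnorm (B *m e j) ^+ 2)%:C%C
    = inner ((absmx A ^+ 2 + absmx B ^+ 2) *m e j) (e j).
  rewrite (rmorphD (real_complex R)) mulmxDl innerDl; symmetry.
  by congr (_ + _); rewrite inner_absmx_sqr innerxx.
rewrite -lecR -modulusE ger0_norm //.
by rewrite ler0c addr_ge0 ?sqr_ge0.
Qed.

Definition pairvec (a b : 'cV[R[i]]_n) : 'cV[R[i]]_(n + n) :=
  ((Num.sqrt 2)^-1)%:C%C *: col_mx a b.

Lemma inner_pairvec (a b c d : 'cV[R[i]]_n) :
  inner (pairvec a b) (pairvec c d) = 2^-1 * (inner a c + inner b d).
Proof.
rewrite /pairvec innerZl innerZr inner_col_mx mulrA; congr (_ * _).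
have -> : ((Num.sqrt 2)^-1)%:C%C^* = ((Num.sqrt 2)^-1)%:C%C :> R[i].
  by rewrite -[LHS]/(conjc _) conjc_real.
by rewrite -rmorphM /= -invfM -expr2 sqr_sqrtr // fmorphV rmorph_nat.
Qed.

Lemma vnorm_pairvec (a b : 'cV[R[i]]_n) :
  vnorm (pairvec a b) ^+ 2 = 2^-1 * (vnorm a ^+ 2 + vnorm b ^+ 2).
Proof.
apply: complexI; rewrite -innerxx inner_pairvec !innerxx -rmorphD.
by rewrite rmorphM fmorphV rmorph_nat.
Qed.

(** The estimate for one entry, for abstract vectors: s, t, p, q play the roles
    of S e_j, T e_l, P e_l, Q e_j.  In the terms that depend on k, s goes
    with q and t with p, as images of the same component of k; in the
    projection term s goes with p and t with q, as both members of such a pair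
    belong to the same summand. *)
Lemma modulus_pairvec_add (s t p q a b fs ft fp fq : 'cV[R[i]]_n) :
    vnorm a = 1 -> vnorm b = 1 ->
    inner s a = inner s fs -> inner t b = inner t ft ->
    inner p a = inner p fp -> inner q b = inner q fq ->
  modulus (inner (pairvec s t + pairvec p q) (pairvec a b)) ^+ 2 <=
    Num.max (modulus (inner s s + 'i%C * inner q q))
            (modulus (inner t t + 'i%C * inner p p))
    * Num.max (modulus (inner fs fs + 'i%C * inner fp fp))
              (modulus (inner ft ft + 'i%C * inner fq fq))
    + 2^-1 * Num.max (vnorm s ^+ 2 + vnorm q ^+ 2) (vnorm p ^+ 2 + vnorm t ^+ 2)
    + 2^-1 * (modulus (inner t q) + modulus (inner s p)).
Proof.
move=> a1 b1 es et ep eq.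
have u1 : vnorm (pairvec a b) = 1.
  apply/eqP; rewrite -(eqrXn2 (n := 2)) ?vnorm_ge0 ?ler01 //.
  by rewrite vnorm_pairvec a1 b1 !expr1n; apply/eqP; field.
have xf : inner (pairvec s t) (pairvec a b) = inner (pairvec s t) (pairvec fs ft).
  by rewrite !inner_pairvec es et.
have yg : inner (pairvec p q) (pairvec a b) = inner (pairvec p q) (pairvec fp fq).
  by rewrite !inner_pairvec ep eq.
(* Only the inner products of the pairs matter from here on, so the pairs
   themselves are forgotten. *)
move: (modulus_add_cs u1 xf yg) (inner_pairvec s t s t) (inner_pairvec p q p q).
move: (inner_pairvec s t p q) (inner_pairvec fs ft fs ft) (inner_pairvec fp fq fp fq).
move: (vnorm_pairvec s t) (vnorm_pairvec p q) => {u1 xf yg}.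
move: (pairvec s t) (pairvec p q) (pairvec fs ft) (pairvec fp fq) (pairvec a b).
move=> x y f g u vx vy xy ff gg h xx yy; apply: le_trans h _.
rewrite xx yy xy ff gg vx vy [inner p p + _]addrC [inner s p + _]addrC !mean_addi.
apply: lerD; first apply: lerD.
- apply: ler_pM; [exact: modulus_ge0 | exact: modulus_ge0 | |].
  + by apply: le_trans (mean_le_max _ _); apply: modulus_mean.
  + by apply: le_trans (mean_le_max _ _); apply: modulus_mean.
- apply: ler_wpM2l; first by rewrite invr_ge0 ler0n.
  apply: le_trans (mean_le_max _ _).
  lra.
- exact: modulus_mean.
Qed.

End Berezin.

(** * Entries of the block matrix *)

Lemma bernorm2_entry (R : realType) (n : nat) (S T P Q : 'M[R[i]]_n)
    (s t : 'I_n * 'I_n) :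
  modulus (inner (block_mx S P Q T *m nkernel_sum R s) (nkernel_sum R t)) ^+ 2 <=
    Num.max (ber (absmx S ^+ 2 + 'i%C *: absmx Q ^+ 2))
            (ber (absmx T ^+ 2 + 'i%C *: absmx P ^+ 2))
    * Num.max (ber (rangeproj S + 'i%C *: rangeproj P))
              (ber (rangeproj T + 'i%C *: rangeproj Q))
    + 2^-1 * Num.max (bernorm (absmx S ^+ 2 + absmx Q ^+ 2))
                     (bernorm (absmx P ^+ 2 + absmx T ^+ 2))
    + 2^-1 * (opnorm (Q ^t* *m T) + opnorm (P ^t* *m S)).
Proof.
case: s t => [j l] [a b].
pose e := @kernel_std R n.
have -> : block_mx S P Q T *m nkernel_sum R (j, l)
    = pairvec (S *m e j) (T *m e l) + pairvec (P *m e l) (Q *m e j).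
  rewrite /nkernel_sum -scalemxAr mul_block_col -scalerDr add_col_mx.
  by rewrite [T *m _ + _]addrC.
apply: le_trans (modulus_pairvec_add (vnorm_delta R a) (vnorm_delta R b)
  (inner_rangeproj S (e j) (e a)) (inner_rangeproj T (e l) (e b))
  (inner_rangeproj P (e l) (e a)) (inner_rangeproj Q (e j) (e b))) _.
apply: lerD; first apply: lerD.
- apply: ler_pM.
  + by rewrite le_max; apply/orP; left; exact: modulus_ge0.
  + by rewrite le_max; apply/orP; left; exact: modulus_ge0.
  + by apply: le_max2; [exact: le_ber_absmx | exact: le_ber_absmx].
  + by apply: le_max2; [exact: le_ber_rangeproj | exact: le_ber_rangeproj].
- apply: ler_wpM2l; first by rewrite invr_ge0 ler0n.
  by apply: le_max2; [exact: le_bernorm_absmx | exact: le_bernorm_absmx].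
- apply: ler_wpM2l; first by rewrite invr_ge0 ler0n.
  apply: lerD; rewrite inner_mulr mulmxA;
    exact: modulus_inner_opnorm (vnorm_delta _ _) (vnorm_delta _ _).
Qed.

Theorem corollary3p19 (R : realType) (n : nat) (n_gt0 : (0 < n)%N)
    (S T P Q : 'M[R[i]]_n) :
  bernorm2 (block_mx S P Q T) ^+ 2 <=
    Num.max (ber (absmx S ^+ 2 + 'i%C *: absmx Q ^+ 2))
            (ber (absmx T ^+ 2 + 'i%C *: absmx P ^+ 2))
    * Num.max (ber (S *m mpinv (absmx S ^+ 2) *m S ^t*
                    + 'i%C *: (P *m mpinv (absmx P ^+ 2) *m P ^t*)))
              (ber (T *m mpinv (absmx T ^+ 2) *m T ^t*
                    + 'i%C *: (Q *m mpinv (absmx Q ^+ 2) *m Q ^t*)))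
    + 2^-1 * Num.max (bernorm (absmx S ^+ 2 + absmx Q ^+ 2))
                     (bernorm (absmx P ^+ 2 + absmx T ^+ 2))
    + 2^-1 * (opnorm (Q ^t* *m T) + opnorm (P ^t* *m S)).
Proof.
have entry := bernorm2_entry S T P Q; move: entry.
rewrite /rangeproj; set b := (X in _ -> _ <= X) => entry.
pose o := Ordinal n_gt0.
(* Nonnegativity of the bound, needed for its square root, comes from one entry
   of the matrix. *)
have b0 : 0 <= b by apply: le_trans (entry (o, o) (o, o)); rewrite sqr_ge0.
have rb : bernorm2 (block_mx S P Q T) <= Num.sqrt b.
  apply: bigmax_le => [|s _]; first exact: sqrtr_ge0.
  apply: bigmax_le => [|t _]; first exact: sqrtr_ge0.
  rewrite -(ler_pXn2r (n := 2)) ?nnegrE ?modulus_ge0 ?sqrtr_ge0 //.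
  by rewrite sqr_sqrtr.
have r0 : 0 <= bernorm2 (block_mx S P Q T).
  exact: bigmax_ge_id.
by rewrite -[leRHS]sqr_sqrtr // ler_pXn2r ?nnegrE ?sqrtr_ge0.
Qed.
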